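(* Let $p$ be an odd prime, $\alpha$ an indeterminate over $\mathbb F_p$, and for $\gamma\in\mathbb F_p(\alpha)$ let \[ G^{(\gamma)}(X)=-\sum_{k=1}^{p-1}\frac{1}{k}\,\frac{X^{k}}{\prod_{s=1}^{k-1}b_{1,s}(\gamma)} \] (empty product equal to $1$). Then for every integer $h$ with $0<h<p$, \[ G^{(h\alpha)}\!\left(\frac{X^h}{\prod_{s=1}^{h-1}b_{1,s}(\alpha)}\right)\equiv h\,G^{(\alpha)}(X)\pmod{X^p-L_{p-1}^{(\alpha^p)}(\alpha^p-\alpha)} \] in the polynomial ring $\mathbb F_p(\alpha)[X]$, where $L_{p-1}^{(\alpha^p)}(\alpha^p-\alpha)$ is obtained from $L_{p-1}^{(\alpha)}(X)$ by substituting $\alpha^p$ for $\alpha$ and $\alpha^p-\alpha$ for $X$.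
   Context: $\mathbb F_p$ is the field of $p$ elements, $\binom{x}{m}=x(x-1)\cdots(x-m+1)/m!$. $L_{p-1}^{(\alpha)}(X)=\sum_{k=0}^{p-1}\binom{\alpha-1}{p-1-k}\frac{(-X)^k}{k!}\in\mathbb F_p[\alpha,X]$. For integers $0<r,s<p$ (interpreted as elements of $\mathbb F_p$), $b_{r,s}(\alpha)=\sum_{k=0}^{p-1}(-r/s)^k\binom{r\alpha-1}{p-1-k}\binom{s\alpha-1}{k}\in\mathbb F_p[\alpha]$, and $b_{1,s}(h\alpha)$ denotes substitution of $h\alpha$ for $\alpha$. *)

(* Defs.v *)
From HB Require Import structures.
From mathcomp Require Import all_boot all_order all_algebra.
Set Implicit Arguments. Unset Strict Implicit. Unset Printing Implicit Defensive.
Import Order.TTheory GRing.Theory.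
Local Open Scope ring_scope.

Definition Fpa (p : nat) := {fraction {poly 'F_p}}.

Definition alpha (p : nat) : Fpa p := tofrac 'X.

Definition binom (K : fieldType) (x : K) (m : nat) : K :=
  (\prod_(i < m) (x - i%:R)) / (m`!)%:R.

Definition bcoef (p : nat) (r s : nat) (g : Fpa p) : Fpa p :=
  \sum_(k < p) (- (r%:R / s%:R)) ^+ k
      * binom (r%:R * g - 1) (p.-1 - k) * binom (s%:R * g - 1) k.

Definition Laguerre (p : nat) (a x : Fpa p) : Fpa p :=
  \sum_(k < p) binom (a - 1) (p.-1 - k) * (- x) ^+ k / (k`!)%:R.

Definition bprod (p : nat) (g : Fpa p) (k : nat) : Fpa p :=
  \prod_(1 <= s < k) bcoef 1 s g.

Definition Gpoly (p : nat) (g : Fpa p) : {poly Fpa p} :=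
  - \sum_(1 <= k < p) ((k%:R)^-1 / bprod g k) *: 'X^k.

Definition modulus (p : nat) : {poly Fpa p} :=
  'X^p - (Laguerre (alpha p ^+ p) (alpha p ^+ p - alpha p))%:P.

(* Main.v *)
Require Import Defs.
From HB Require Import structures.
From mathcomp Require Import all_boot all_order all_algebra.
From mathcomp Require Import ring zify.
Import GRing.Theory.
Local Open Scope ring_scope.

(** Fix [a] and put [E_k = L^(ka)(kX)] and [m = X^p - (a^p - a)].  Modulo [m],
    [E_k] satisfies [X y' = k (X - a) y], and the solutions of that equation
    form a line when [k] is nonzero.  Hence [E_h E_(sh)] is a multiple of
    [E_((s+1)h)]; comparing coefficients of [X^(p-1)], the factor is
    [b_(1,s)(ha)], so that [E_h^k] is [E_(kh)] times [b_(1,1)(ha) ...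
    b_(1,k-1)(ha)].  Therefore [G^(ha)(E_h) = - sum_k E_(kh) / k = h X] modulo
    [m] by evaluating power sums over [F_p], and both sides of the theorem
    agree once [E_1] is substituted for [X].  Since [G^(a)(E_1) = X], the
    substitution [P |-> P(E_1)] has kernel exactly [X^p - E_1^p], where [E_1^p]
    is the constant [L^(a^p)(a^p - a)]. *)

(** * Reduction of sums and powers modulo a polynomial *)

Lemma modp_sum (F : fieldType) (I : Type) (r : seq I) (P : pred I)
    (f : I -> {poly F}) (d : {poly F}) :
  (\sum_(i <- r | P i) f i) %% d = \sum_(i <- r | P i) (f i %% d).
Proof. exact: (big_morph (fun q => q %% d) (modpD d) (mod0p d)). Qed.

Lemma modp_exp (F : fieldType) (q d : {poly F}) (n : nat) :
  ((q %% d) ^+ n) %% d = (q ^+ n) %% d.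
Proof.
elim: n => [|n IHn]; first by rewrite !expr0.
by rewrite !exprS -[LHS]modp_mul IHn modp_mul mulrC modp_mul mulrC.
Qed.

(** * Factorials, binomials and power sums in characteristic [p] *)

Section PrimeCharacteristic.

#[local] Set Implicit Arguments.
#[local] Unset Strict Implicit.

Variables (K : fieldType) (p : nat).
Hypothesis charK : p \in [pchar K].

Let pr_p : prime p := pcharf_prime charK.
Let p_gt0 : (0 < p)%N := prime_gt0 pr_p.
Let p_gt1 : (1 < p)%N := prime_gt1 pr_p.

Lemma natr_neq0 k : (0 < k < p)%N -> k%:R != 0 :> K.
Proof.
case/andP=> k0 kp; rewrite -(dvdn_pcharf charK); apply/negP=> /(dvdn_leq k0).
by rewrite leqNgt kp.
Qed.

Lemma natr_expp k : (k%:R : K) ^+ p = k%:R.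
Proof. exact: (pFrobenius_aut_nat charK). Qed.

Lemma natr_expp1 k : k%:R != 0 :> K -> (k%:R : K) ^+ p.-1 = 1.
Proof.
by move=> k0; apply: (mulfI k0); rewrite -exprS prednK // natr_expp mulr1.
Qed.

Lemma fact_neq0 k : (k < p)%N -> (k`!)%:R != 0 :> K.
Proof.
elim: k => [|k IHk] kp; first by rewrite fact0 oner_neq0.
by rewrite factS natrM mulf_neq0 ?IHk ?(ltnW kp) // natr_neq0.
Qed.

Lemma natr_Wilson : (p.-1)`!%:R = -1 :> K.
Proof.
have := pr_p; rewrite Wilson // (dvdn_pcharf charK) -addn1 natrD addr_eq0.
by move/eqP.
Qed.

(** Induction from Wilson's theorem: raising [i] by one replaces the factor [p - 1 - i], which
    equals [-(i + 1)] in [K], by [i + 1], so only the sign changes. *)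
Lemma natr_fact_compl i : (i < p)%N ->
  i`!%:R * (p.-1 - i)`!%:R = - (-1) ^+ i :> K.
Proof.
elim: i => [|i IHi] ip; first by rewrite fact0 mul1r subn0 natr_Wilson.
have i0 : i.+1%:R != 0 :> K by apply: natr_neq0.
have iE : (p.-1 - i)%:R = - i.+1%:R :> K.
  apply/eqP; rewrite -addr_eq0 -natrD -(dvdn_pcharf charK).
  by have -> : (p.-1 - i + i.+1 = p)%N by lia.
have := IHi (ltnW ip); have -> : (p.-1 - i = (p.-1 - i.+1).+1)%N by lia.
rewrite factS natrM; have -> : ((p.-1 - i.+1).+1 = p.-1 - i)%N by lia.
rewrite iE factS natrM exprS mulN1r => /(congr1 -%R); rewrite opprK => <-.
ring.
Qed.

Lemma binom0 (x : K) : binom x 0 = 1.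
Proof. by rewrite /binom big_ord0 fact0 divr1. Qed.

Lemma binomS (x : K) m : (m.+1 < p)%N ->
  binom x m.+1 * m.+1%:R = binom x m * (x - m%:R).
Proof.
move=> mp; rewrite /binom big_ord_recr /= factS natrM.
have f0 : m`!%:R != 0 :> K by rewrite fact_neq0 // ltnW.
have m0 : m.+1%:R != 0 :> K by rewrite natr_neq0.
by move: m.+1%:R m0 => u u0; field; rewrite f0 u0.
Qed.

Lemma binom_opp1 m : (m < p)%N -> binom (-1 : K) m = (-1) ^+ m.
Proof.
elim: m => [|m IHm] mp; first by rewrite binom0.
have m0 : m.+1%:R != 0 :> K by rewrite natr_neq0.
apply: (mulIf m0); rewrite binomS // IHm ?(ltnW mp) // exprS -natr1; ring.
Qed.

(** By Fermat the [p] distinct residues are roots of the monic polynomial [X^p - X], hence all of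
    them. *)
Lemma prod_sub_natr (x : K) : \prod_(i < p) (x - i%:R) = x ^+ p - x.
Proof.
pose rs := [seq i%:R : K | i <- iota 0 p].
have sz : size ('X^p - 'X : {poly K}) = p.+1.
  by rewrite size_polyDl size_polyXn // size_polyN size_polyX.
have lc : lead_coef ('X^p - 'X : {poly K}) = 1.
  by rewrite lead_coefDl ?lead_coefXn // size_polyN size_polyX size_polyXn.
have := @all_roots_prod_XsubC _ ('X^p - 'X : {poly K}) rs.
rewrite sz size_map size_iota => /(_ erefl).
rewrite lc scale1r => E.
have /(congr1 (horner^~ x)) : 'X^p - 'X = \prod_(z <- rs) ('X - z%:P).
  apply: E.
    by apply/allP=> _ /mapP[i _ ->]; rewrite rootE !hornerE natr_expp subrr.
  rewrite uniq_rootsE map_inj_in_uniq ?iota_uniq // => i j.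
  rewrite !mem_iota /= add0n => ip jp.
  wlog ij : i j ip jp / (i <= j)%N => [H|].
    by case/orP: (leq_total i j) => [/H|/H h /esym/h->] //; apply.
  move/eqP; rewrite eq_sym -subr_eq0 -natrB // -(dvdn_pcharf charK) => /eqP.
  rewrite modn_small; lia.
rewrite !hornerE horner_prod big_map -[p in iota 0 p]subn0 big_mkord => ->.
by apply: eq_bigr => i _; rewrite !hornerE.
Qed.

Lemma binom_sub1_predp (x : K) : odd p -> binom (x - 1) p.-1 = 1 - x ^+ p.-1.
Proof.
move=> odd_p; have p1 : p.-1.+1 = p by rewrite prednK.
(* For nonzero [x], the product [(x - 1) ... (x - (p-1))] is [(x^p - x) / x]; the value at 0 is
   computed separately. *)
have [->|x0] := eqVneq x 0.
  rewrite sub0r binom_opp1 ?ltn_predL // expr0n -signr_odd.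
  have -> : (p.-1 == 0)%N = false by lia.
  have -> : odd p.-1 = false by lia.
  by rewrite subr0.
apply: (mulfI x0); rewrite mulrBr mulr1 -exprS p1 /binom natr_Wilson.
have := prod_sub_natr x; rewrite -(big_mkord xpredT (fun i => x - i%:R)).
rewrite -[X in index_iota 0 X]p1 big_nat_recl // big_mkord subr0.
under eq_bigr do rewrite -addn1 natrD opprD addrA [_ - 1]addrC addrA
  [- 1 + _]addrC.
by move=> E; rewrite mulrA E invrN invr1 mulrN mulr1 opprB.
Qed.

(* Telescoping [(k+1)^(m+1) - k^(m+1)] gives [(m+1) S_m] plus lower power
   sums [S_j] *)
Lemma sum_natr_exp m : (m < p.-1)%N -> \sum_(k < p) (k%:R : K) ^+ m = 0.
Proof.
elim/ltn_ind: m => m IHm mp.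
have m0 : m.+1%:R != 0 :> K by rewrite natr_neq0 //; lia.
apply: (mulfI m0); rewrite mulr0.
have tel : \sum_(k < p) ((k.+1%:R : K) ^+ m.+1 - k%:R ^+ m.+1) = 0.
  rewrite -(big_mkord xpredT (fun k => (k.+1%:R : K) ^+ m.+1 - k%:R ^+ m.+1)).
  by rewrite telescope_sumr // (pcharf0 charK) !expr0n subrr.
rewrite -[RHS]tel.
under [RHS]eq_bigr => k _ do rewrite -natr1 exprD1n big_ord_recr /= binn mulr1n
  addrK big_ord_recr /=.
rewrite big_split /= exchange_big [X in _ = X + _]big1 ?add0r /= => [|i _].
  by rewrite mulr_sumr; apply: eq_bigr => k _; rewrite binSn mulr_natl.
  by rewrite sumrMnl IHm ?mul0rn //; have := ltn_ord i; lia.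
Qed.

(** The sum over all residues vanishes because only power sums of exponent below [p - 1] occur; the
    right side accounts for the missing term [k = 0]. *)
Lemma sum_horner_natr (f : {poly K}) : (size f <= p.-1)%N ->
  \sum_(1 <= k < p) f.[k%:R] = - f.[0].
Proof.
move=> sz; apply/eqP; rewrite -subr_eq0 opprK addrC; apply/eqP.
rewrite -[f.[0]]/(f.[0%:R]) -(big_ltn (F := fun k => f.[k%:R]) p_gt0).
rewrite big_mkord; under eq_bigr do rewrite horner_coef.
rewrite exchange_big big1 //= => i _.
by rewrite -mulr_sumr sum_natr_exp ?mulr0 // (leq_trans (ltn_ord i)).
Qed.

End PrimeCharacteristic.

(* [L^(ka)(kX)], an analogue of the [k]-th power of [exp(X) X^(-a)] *)
Definition dlag {K : fieldType} (p : nat) (a : K) (k : nat) : {poly K} :=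
  \poly_(j < p) (binom (k%:R * a - 1) (p.-1 - j) * (- k%:R) ^+ j / j`!%:R).

(** In characteristic [p] this polynomial has derivative 0, so differentiation passes to the
    quotient by it. *)
Definition asmod {K : fieldType} (p : nat) (a : K) : {poly K} :=
  'X^p - (a ^+ p - a)%:P.

(** * The differential equation of [dlag] and the products of its solutions *)

Section DilatedLaguerre.

#[local] Set Implicit Arguments.
#[local] Unset Strict Implicit.

Variables (K : fieldType) (p : nat).
Hypotheses (charK : p \in [pchar K]) (odd_p : odd p).

Let pr_p : prime p := pcharf_prime charK.
Let p_gt0 : (0 < p)%N := prime_gt0 pr_p.
Let p1 : p.-1.+1 = p := prednK p_gt0.

Variable a : K.

Local Notation E := (dlag p a).
Local Notation m := (asmod p a).

Lemma size_asmod : size m = p.+1.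
Proof. exact: size_XnsubC. Qed.

Lemma asmod_neq0 : m != 0.
Proof. by rewrite -size_poly_eq0 size_asmod. Qed.

Lemma size_modp_asmod (f : {poly K}) : (size (f %% m)%R <= p)%N.
Proof. by rewrite -ltnS -size_asmod ltn_modp asmod_neq0. Qed.

Lemma asmod_modp : 'X^p %% m = (a ^+ p - a)%:P.
Proof.
have -> : 'X^p = m + (a ^+ p - a)%:P by rewrite subrK.
rewrite modpD modpp add0r modp_small // size_asmod.
exact: leq_ltn_trans (size_polyC_leq1 _) _.
Qed.

Lemma size_dlag k : (size (E k) <= p)%N.
Proof. exact: size_poly. Qed.

(** This is [X y' = k (X - a) y] in degree [i + 1]. It comes from [binomS] at [n = p - 2 - i], where
    [n = -(i + 2)] in [K]. *)
Lemma coef_dlag_rec k i : (i.+1 < p)%N ->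
  (i.+1%:R + k%:R * a) * (E k)`_i.+1 = k%:R * (E k)`_i.
Proof.
move=> ip; rewrite !coef_poly ip (ltnW ip).
have [n pE] : exists n, p = (n + i).+2 by exists (p - i.+2)%N; lia.
have -> : (p.-1 - i = n.+1)%N by lia.
have -> : (p.-1 - i.+1 = n)%N by lia.
have np : (n.+1 < p)%N by lia.
have /(congr1 (fun z => z / n.+1%:R)) := binomS charK (k%:R * a - 1) np.
have n0 : n.+1%:R != 0 :> K by apply: (natr_neq0 charK); lia.
have i0 : i.+1%:R != 0 :> K by apply: (natr_neq0 charK); lia.
have f0 : i`!%:R != 0 :> K by apply: (fact_neq0 charK); lia.
have nE : n%:R = - (i.+1%:R + 1) :> K.
  apply/eqP; rewrite -addr_eq0 natr1 -natrD -(dvdn_pcharf charK).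
  by rewrite pE -addnS -addnS.
have n1E : n.+1%:R = - i.+1%:R :> K by rewrite -natr1 nE; ring.
rewrite mulfK // n1E nE => ->; rewrite factS natrM exprS.
move: i.+1%:R i0 (i`!%:R : K) f0 => u u0 v v0.
by field; rewrite v0 oppr_eq0 u0.
Qed.

Lemma coef_dlag_last k : (E k)`_p.-1 = - k%:R ^+ p.-1.
Proof.
rewrite coef_poly ltn_predL p_gt0 subnn binom0 mul1r natr_Wilson // exprNn.
rewrite -signr_odd; have -> : odd p.-1 = false by lia.
by rewrite mul1r invrN invr1 mulrN mulr1.
Qed.

Lemma coef_dlag0 k : (E k)`_0 = 1 - (k%:R * a) ^+ p.-1.
Proof.
by rewrite coef_poly p_gt0 subn0 binom_sub1_predp // fact0 divr1 expr0 mulr1.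
Qed.

(** The recurrence settles degrees 1 to [p - 1]; the defects in degrees 0 and [p] are exactly the
    two terms of [k m]. *)
Lemma dlag_ode k :
  'X * (E k)^`() = k%:R *: (('X - a%:P) * E k + m).
Proof.
apply/polyP=> i; rewrite coefXM coefZ coefD mulrBl coefB coefXM coefCM coefB.
rewrite coefXn coefC.
case: i => [|i] /=.
  rewrite eq_sym (gtn_eqF p_gt0) coef_dlag0 !sub0r.
  have := natr_expp charK k; have := exprS (k%:R * a) p.-1.
  rewrite p1 exprMn => E1 E2; rewrite E2 in E1.
  have -> : k%:R * (- (a * (1 - (k%:R * a) ^+ p.-1)) - (a ^+ p - a))
    = k%:R * a * (k%:R * a) ^+ p.-1 - k%:R * a ^+ p by ring.
  by rewrite -E1 subrr.
rewrite coef_deriv subr0.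
have [ip|ip] := ltnP i.+1 p.
  rewrite (ltn_eqF ip) addr0 mulrBr -(coef_dlag_rec k ip) -mulr_natl; ring.
rewrite [(E k)`_i.+1]nth_default ?(leq_trans (size_dlag k)) //.
rewrite mul0rn mulr0 subr0.
move: ip; rewrite leq_eqVlt => /orP[/eqP ip|ip].
  have -> : i = p.-1 by lia.
  rewrite p1 eqxx coef_dlag_last mulrDr mulrN -exprS p1 (natr_expp charK).
  by rewrite mulr1 addNr.
rewrite (gtn_eqF ip) [(E k)`_i]nth_default ?addr0 ?mulr0 //.
by rewrite (leq_trans (size_dlag k)).
Qed.

(** By degrees the quotient by [m] is a constant, and [m] has no terms in degrees 1 to [p - 1]. The
    coefficient recurrence therefore holds there, and as [k] is invertible it determines [f]
    downwards from its coefficient in degree [p - 1]. *)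
Lemma eigen_unique k (f : {poly K}) : k%:R != 0 :> K -> (size f <= p)%N ->
  m %| 'X * f^`() - k%:R *: (('X - a%:P) * f) -> f`_p.-1 = 0 -> f = 0.
Proof.
move=> k0 szf /dvdpP[q qE] flast.
have szq : (size q <= 1)%N.
  have [->|q0] := eqVneq q 0; first by rewrite size_poly0.
  have := size_mul q0 asmod_neq0; rewrite size_asmod -qE addnS /= => szE.
  have : (size ('X * f^`() - k%:R *: (('X - a%:P) * f))%R <= p.+1)%N.
    apply: (leq_trans (size_polyD _ _)); rewrite geq_max size_polyN.
    apply/andP; split.
      apply: (leq_trans (size_polyMleq _ _)); rewrite size_polyX /=.
      apply: leq_trans (_ : (size f).+1 <= _)%N; last by [].
      by rewrite ltnS (leq_trans (size_poly _ _)) // leq_pred.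
    apply: (leq_trans (size_scale_leq _ _)).
    by apply: (leq_trans (size_polyMleq _ _)); rewrite size_XsubC.
  by rewrite szE addnC -addn1 leq_add2l.
have {szq qE} rec i : (i.+1 < p)%N ->
    k%:R * f`_i = (i.+1%:R + k%:R * a) * f`_i.+1.
  move=> ip; move: qE; rewrite (size1_polyC szq) mul_polyC => /polyP/(_ i.+1).
  rewrite coefB coefXM coefZ mulrBl coefB coefXM coefCM coefZ.
  rewrite coefB coefXn coefC (ltn_eqF ip) /= coef_deriv subrr mulr0 => /eqP.
  rewrite subr_eq0 => /eqP E1.
  by rewrite mulrDl [i.+1%:R * _]mulr_natl E1; ring.
have zero j : (j < p)%N -> f`_(p.-1 - j) = 0.
  elim: j => [|j IHj] jp; first by rewrite subn0.
  apply: (mulfI k0); rewrite rec; last lia.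
  have -> : ((p.-1 - j.+1).+1 = p.-1 - j)%N by lia.
  by rewrite IHj ?mulr0 //; lia.
apply/polyP=> i; rewrite coef0.
have [ip|ip] := ltnP i p; last by rewrite nth_default // (leq_trans szf).
have -> : i = (p.-1 - (p.-1 - i))%N by lia.
by rewrite zero //; lia.
Qed.

(** The top coefficient of [E k] is [-k^(p-1) = -1], so adding the right multiple of [E k] to
    [f %% m] kills degree [p - 1]. The equation survives reduction because [m' = 0], and
    [eigen_unique] applies. *)
Lemma eigen_dlag k (f : {poly K}) : k%:R != 0 :> K ->
  m %| 'X * f^`() - k%:R *: (('X - a%:P) * f) ->
  f %% m = - (f %% m)`_p.-1 *: E k.
Proof.
move=> k0 fE; apply/eqP; rewrite scaleNr -addr_eq0; apply/eqP.
apply: (eigen_unique k0).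
- rewrite (leq_trans (size_polyD _ _)) // geq_max size_modp_asmod.
  by rewrite (leq_trans (size_scale_leq _ _)) ?size_dlag.
- set c := _`_p.-1.
  have dm : m^`() = 0.
    by rewrite derivB derivXn derivC subr0 -mulr_natl -[p%:R]polyC_natr
      (pcharf0 charK) mul0r.
  have modE : f %% m = f - f %/ m * m.
    by apply/eqP; rewrite eq_sym subr_eq addrC -divp_eq.
  have -> : 'X * (f %% m + c *: E k)^`()
      - k%:R *: (('X - a%:P) * (f %% m + c *: E k)) =
    ('X * f^`() - k%:R *: (('X - a%:P) * f))
    + (- 'X * (f %/ m)^`() + k%:R *: (('X - a%:P) * (f %/ m)) + (k%:R * c)%:P)
      * m.
    rewrite modE derivD derivB derivZ derivM dm mulr0 addr0.
    rewrite [_ * (_ + c *: _)]mulrDr -[_ * (c *: _)]scalerAr dlag_ode.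
    rewrite -!mul_polyC polyCM; ring.
  by rewrite dvdp_add // dvdp_mull.
- by rewrite coefD coefZ coef_dlag_last natr_expp1 // mulrN1 addrN.
Qed.

(** Logarithmic derivatives add under multiplication. *)
Lemma dlag_mul_eigen r s :
  m %| 'X * (E r * E s)^`() - (r + s)%:R *: (('X - a%:P) * (E r * E s)).
Proof.
have -> : 'X * (E r * E s)^`() - (r + s)%:R *: (('X - a%:P) * (E r * E s)) =
  (r%:R *: E s + s%:R *: E r) * m.
  rewrite derivM mulrDr mulrA dlag_ode mulrCA dlag_ode natrD -!mul_polyC polyCD.
  ring.
exact: dvdp_mull.
Qed.

(** The quotient [q] has degree below [p - 1], so neither [q X^p] nor a constant multiple of [q]
    reaches degree [p - 1]. *)
Lemma coef_modp_last (f : {poly K}) : (size f <= p + p.-1)%N ->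
  (f %% m)`_p.-1 = f`_p.-1.
Proof.
move=> szf; rewrite {2}(divp_eq f m) coefD mulrBr coefB coefMXn coefMC.
rewrite ltn_predL p_gt0 [(f %/ m)`__]nth_default ?mul0r ?subr0 ?add0r //.
by rewrite size_divp ?asmod_neq0 // size_asmod leq_subLR.
Qed.

(** The factor is [bcoef 1 s] at [h a], written out because [K] is arbitrary here. In the
    convolution for the coefficient of [X^(p-1)], the powers of [h] combine to [h^(p-1) = 1], and
    [natr_fact_compl] turns the factorials into signs. *)
Lemma dlag_mul h s : h%:R != 0 :> K -> (0 < s)%N -> (s.+1 < p)%N ->
  (E h * E (s * h)) %% m =
    (\sum_(k < p) (- (1%:R / s%:R)) ^+ k
      * binom (1%:R * (h%:R * a) - 1) (p.-1 - k)
      * binom (s%:R * (h%:R * a) - 1) k) *: E (s.+1 * h).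
Proof.
move=> h0 s_gt0 sp.
have s0 : s%:R != 0 :> K by apply: (natr_neq0 charK); lia.
have sS0 : s.+1%:R != 0 :> K by apply: (natr_neq0 charK); lia.
have k0 : (s.+1 * h)%:R != 0 :> K by rewrite natrM mulf_neq0.
rewrite (eigen_dlag k0); last first.
  by have := dlag_mul_eigen h (s * h); rewrite -mulSn.
congr (_ *: _); rewrite coef_modp_last; last first.
  apply: (leq_trans (size_polyMleq _ _)).
  by have := size_dlag h; have := size_dlag (s * h); lia.
rewrite coefM p1 -sumrN; apply: eq_bigr => i _; have ip := ltn_ord i.
rewrite !coef_poly ip; have -> : (p.-1 - i < p)%N by lia.
have -> : (p.-1 - (p.-1 - i) = i)%N by lia.
have powE : (- h%:R) ^+ i * (- (s * h)%:R) ^+ (p.-1 - i) = s%:R ^- i :> K.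
  have si0 : s%:R ^+ i != 0 :> K by rewrite expf_neq0.
  apply: (mulIf si0); rewrite mulVf // natrM -mulrN exprMn mulrCA mulrAC.
  rewrite -!exprD subnK ?subnKC; try lia.
  rewrite (natr_expp1 charK) // mul1r exprNn (natr_expp1 charK) // mulr1.
  by rewrite -signr_odd; have -> : odd p.-1 = false by lia.
have factE := natr_fact_compl charK ip.
have {}factE := congr1 GRing.inv factE; rewrite invrN invr_sign in factE.
have i0 : i`!%:R != 0 :> K by apply: (fact_neq0 charK).
have j0 : (p.-1 - i)`!%:R != 0 :> K by apply: (fact_neq0 charK); lia.
have -> : (s * h)%:R * a = s%:R * (h%:R * a) by rewrite natrM mulrA.
rewrite !mul1r [(- s%:R^-1) ^+ i]exprNn exprVn -powE -[(-1) ^+ i]opprK -factE.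
move: (_ ^+ i) (_ ^+ (p.-1 - i)) (i`!%:R : K) i0 ((p.-1 - i)`!%:R : K) j0.
by move=> e e' u u0 v v0; field; rewrite u0 v0.
Qed.

End DilatedLaguerre.

(** * Substitution modulo a polynomial *)

Lemma modp_comp (F : fieldType) (P q d : {poly F}) :
  (P \Po (q %% d)) %% d = (P \Po q) %% d.
Proof.
rewrite !comp_polyE !modp_sum; apply: eq_bigr => i _.
by rewrite !modpZl modp_exp.
Qed.

Lemma poly_rV_mul_powers (F : fieldType) n (m e P : {poly F}) :
  (size P <= n)%N ->
  poly_rV P *m (\matrix_(i < n) poly_rV ((e ^+ i) %% m) : 'M_n)
    = poly_rV ((P \Po e) %% m).
Proof.
move=> szP; rewrite mulmx_sum_row comp_polyE.
have -> : \sum_(i < size P) P`_i *: e ^+ i = \sum_(i < n) P`_i *: e ^+ i.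
  rewrite (big_ord_widen n (fun i => P`_i *: e ^+ i) szP) big_mkcond.
  by apply: eq_bigr => i _; case: ltnP => // ?; rewrite nth_default ?scale0r.
rewrite modp_sum linear_sum; apply: eq_bigr => i _.
by rewrite rowK mxE modpZl linearZ.
Qed.

(* The map [P |-> P(e)] from [F[X]/M] to [F[X]/m] is onto, since [g(e)] is the
   generator; both sides have dimension [n], so it is also injective *)
Lemma dvdp_of_comp_modp0 (F : fieldType) n (m M e g Q : {poly F}) :
  size m = n.+1 -> size M = n.+1 ->
  (M \Po e) %% m = 0 -> (g \Po e) %% m = 'X %% m ->
  (Q \Po e) %% m = 0 -> M %| Q.
Proof.
move=> szm szM Me ge Qe.
have M0 : M != 0 by rewrite -size_poly_eq0 szM.
have modM P : ((P %% M) \Po e) %% m = (P \Po e) %% m.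
  rewrite [in RHS](divp_eq P M) comp_polyD comp_polyM modpD.
  by rewrite -[in RHS]modp_mul Me mulr0 mod0p add0r.
have szmod P : (size (P %% M)%R <= n)%N by rewrite -ltnS -szM ltn_modp.
pose A : 'M[F]_n := \matrix_(i < n) poly_rV ((e ^+ i) %% m).
pose B : 'M[F]_n := \matrix_(i < n) poly_rV ((g ^+ i) %% M).
(* Row [j] of the product represents [g(e)^j], which is [X^j] modulo [m]. Both matrices are square,
   so [A *m B] is the identity as well and [A] can be cancelled on the right. *)
have BA : B *m A = 1%:M.
  apply/row_matrixP => j; rewrite row_mul rowK poly_rV_mul_powers // modM.
  rewrite rmorphXn /= -modp_exp ge modp_exp modp_small; last first.
    by rewrite size_polyXn szm ltnS.
  by apply/rowP=> i; rewrite !mxE coefXn eq_sym.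
have /(congr1 (mulmx^~ B)) : poly_rV (Q %% M) *m A = 0.
  by rewrite poly_rV_mul_powers // modM Qe linear0.
rewrite mul0mx -mulmxA (mulmx1C BA) mulmx1 => /(congr1 rVpoly).
by rewrite poly_rV_K // (linear0 rVpoly) => E0; rewrite /dvdp E0 eqxx.
Qed.

(** Under [X |-> e] both terms become [c X] modulo [m]: [e^h / b] reduces to [eh], and [g(e)] to
    [X]. The previous lemma lifts this to a congruence modulo [X^n - lam]. *)
Lemma dvdp_comp_inverse (F : fieldType) n h (m e g eh gh : {poly F})
    (b c lam : F) :
  (1 < n)%N -> size m = n.+1 -> (e ^+ n) %% m = lam%:P ->
  b != 0 -> (e ^+ h) %% m = b *: eh ->
  (g \Po e) %% m = 'X -> (gh \Po eh) %% m = c *: 'X ->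
  'X^n - lam%:P %| (gh \Po (b^-1 *: 'X^h)) - c *: g.
Proof.
move=> n_gt1 szm en b0 eh_E ge gheh; have n_gt0 := ltnW n_gt1.
apply: (dvdp_of_comp_modp0 _ n m _ e g) => //.
- by rewrite size_XnsubC.
- rewrite comp_polyB comp_polyC rmorphXn /= comp_polyX modpD modpN en.
  rewrite modp_small ?subrr // szm ltnS.
  exact: leq_trans (size_polyC_leq1 _) n_gt0.
- by rewrite ge modp_small // size_polyX szm ltnS.
- rewrite comp_polyB modpD modpN -comp_polyA !comp_polyZ modpZl ge.
  rewrite rmorphXn /= comp_polyX -modp_comp modpZl eh_E scalerA mulVf //.
  by rewrite scale1r gheh subrr.
Qed.

(** * Powers of [E 1] and the sum of the [E (k * h)] over [k] *)

Section LaguerrePowers.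

#[local] Set Implicit Arguments.
#[local] Unset Strict Implicit.

Variables (K : fieldType) (p : nat).
Hypotheses (charK : p \in [pchar K]) (odd_p : odd p).

Let pr_p : prime p := pcharf_prime charK.
Let p_gt0 : (0 < p)%N := prime_gt0 pr_p.
Let p_gt1 : (1 < p)%N := prime_gt1 pr_p.

Variable a : K.

Local Notation E := (dlag p a).
Local Notation m := (asmod p a).

Lemma binom_expp (x : K) n : (binom x n) ^+ p = binom (x ^+ p) n.
Proof.
rewrite /binom -![_ ^+ p](pFrobenius_autE charK) rmorphM fmorphV /=.
rewrite pFrobenius_aut_nat rmorph_prod; congr (_ / _); apply: eq_bigr => i _.
by rewrite rmorphB /= pFrobenius_aut_nat.
Qed.

(** Frobenius acts termwise: it sends [a] to [a^p], fixes the factorials, and turns [X^k] into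
    [X^(p k)], that is [(a^p - a)^k] modulo [m]. *)
Lemma dlag1_expp : (E 1) ^+ p %% m =
  (\sum_(k < p) binom (a ^+ p - 1) (p.-1 - k) * (- (a ^+ p - a)) ^+ k
     / k`!%:R)%:P.
Proof.
have charP : p \in [pchar {poly K}] by rewrite pchar_poly.
have charFE (R : comNzRingType) (c : p \in [pchar R]) (x : R) :
  pFrobenius_aut c x = x ^+ p by [].
rewrite /dlag poly_def -(charFE _ charP) rmorph_sum /= modp_sum rmorph_sum /=.
apply: eq_bigr => k _; rewrite charFE exprZn modpZl -exprM mulnC exprM.
rewrite -modp_exp asmod_modp // -polyC_exp modp_small; last first.
  by rewrite (size_asmod charK) (leq_ltn_trans (size_polyC_leq1 _)).
rewrite -mul_polyC -polyCM; congr _%:P.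
rewrite mul1r -[in LHS](mulrA (binom _ _)) exprMn binom_expp !exprMn exprVn.
rewrite (natr_expp charK) -[in LHS](charFE _ charK) rmorphB /=.
rewrite pFrobenius_aut1 !charFE [(_ ^+ k) ^+ p]exprAC.
have -> : (-1 : K) ^+ p = -1 by rewrite -signr_odd odd_p.
rewrite [(- _) ^+ k in RHS]exprNn; ring.
Qed.

(** Otherwise the [p]-th power of [E_1^n] would vanish modulo [m], yet it is the [n]-th power of a
    nonzero constant. *)
Lemma dlag1_exp_neq0 n : (E 1) ^+ p %% m != 0 -> (E 1) ^+ n %% m != 0.
Proof.
rewrite dlag1_expp; set c := \sum_(k < p) _ => c0.
have {}c0 : c != 0 by move: c0; rewrite polyC_eq0.
apply/eqP => /(congr1 (fun q => (q ^+ p) %% m)).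
rewrite modp_exp expr0n (gtn_eqF p_gt0) mod0p -exprM mulnC exprM -modp_exp.
rewrite dlag1_expp -/c -polyC_exp modp_small; last first.
  by rewrite (size_asmod charK) (leq_ltn_trans (size_polyC_leq1 _)).
by move/eqP; rewrite polyC_eq0 expf_eq0 (negPf c0) andbF.
Qed.

Lemma size_prod_affine (y : K) (d : nat -> K) n :
  (size (\prod_(i < n) (y *: 'X - (d i)%:P))%R <= n.+1)%N.
Proof.
elim: n => [|n IHn]; first by rewrite big_ord0 size_poly1.
rewrite big_ord_recr /=; apply: (leq_trans (size_polyMleq _ _)).
have : (size (y *: 'X - (d n)%:P)%R <= 2)%N.
  rewrite (leq_trans (size_polyD _ _)) // geq_max size_polyN.
  rewrite (leq_trans (size_scale_leq _ _)) ?size_polyX //=.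
  exact: leq_trans (size_polyC_leq1 _) _.
move: IHn; set u := size _; set v := size _; lia.
Qed.

(** In each degree, the coefficient of [E_(kh) / k] is a polynomial in [k] of degree at most
    [p - 2], so [sum_horner_natr] reduces the sum to its value at [k = 0]. *)
Lemma sum_inv_dlag h :
  - \sum_(1 <= k < p) (k%:R)^-1 *: E (k * h) = h%:R *: 'X.
Proof.
apply/polyP=> j; rewrite coefN coef_sum coefZ coefX.
have knz k : (0 < k < p)%N -> k%:R != 0 :> K by apply: natr_neq0.
have [jp|jp] := ltnP j p; last first.
  rewrite big1 => [|k _].
    by rewrite oppr0 gtn_eqF ?mulr0 ?(leq_trans _ jp).
  by rewrite coefZ nth_default ?mulr0 // (leq_trans (size_dlag _ _ _)).
case: j jp => [|j] jp.
  (* In degree 0 the dependence on [k] is [1/k = k^(p-2)], and [p - 2] is positive since [p] is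
     odd. *)
  have S0 : \sum_(1 <= k < p) ('X^(p - 2)).[k%:R] = 0 :> K.
    rewrite (sum_horner_natr charK) ?size_polyXn; last lia.
    rewrite hornerXn expr0n; have -> : (p - 2 == 0)%N = false by lia.
    by rewrite oppr0.
  apply/eqP; rewrite mulr0 oppr_eq0; apply/eqP.
  transitivity ((1 - (h%:R * a) ^+ p.-1)
      * \sum_(1 <= k < p) ('X^(p - 2)).[k%:R]);
    last by rewrite S0 mulr0.
  rewrite mulr_sumr; apply: eq_big_nat => k /knz k0.
  rewrite coefZ (coef_dlag0 charK odd_p) natrM -mulrA exprMn.
  rewrite (natr_expp1 charK) //.
  rewrite mul1r mulrC hornerXn; congr (_ * _).
  apply: (mulfI k0); rewrite mulfV // -exprS.
  by rewrite -[LHS](natr_expp1 charK k0); congr (_ ^+ _); lia.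
pose y := h%:R * a.
(* The variable of [f] stands for [k]: the factor [1/k] lowers [k^(j+1)] to [k^j], and the binomial
   contributes degree [p - 2 - j]. *)
pose f : {poly K} :=
  'X^j * \prod_(i < p.-1 - j.+1) (y *: 'X - (1 + i%:R)%:P).
have szf : (size f <= p.-1)%N.
  apply: (leq_trans (size_polyMleq _ _)); rewrite size_polyXn.
  have := size_prod_affine y (fun i => 1 + i%:R) (p.-1 - j.+1).
  set v := size _; move: jp; clear; lia.
have v0 : (p.-1 - j.+1)`!%:R != 0 :> K by apply: (fact_neq0 charK); lia.
have fE k : f.[k%:R] = k%:R ^+ j *
    (binom (k%:R * y - 1) (p.-1 - j.+1) * (p.-1 - j.+1)`!%:R).
  rewrite /f hornerM hornerXn horner_prod /binom divfK //; congr (_ * _).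
  apply: eq_bigr => i _.
  by rewrite !(hornerD, hornerN, hornerZ, hornerX, hornerC); ring.
pose c : K := (- h%:R) ^+ j.+1 / (j.+1)`!%:R / (p.-1 - j.+1)`!%:R.
have -> : \sum_(1 <= k < p) ((k%:R)^-1 *: E (k * h))`_j.+1
    = c * \sum_(1 <= k < p) f.[k%:R].
  rewrite mulr_sumr; apply: eq_big_nat => k /knz k0.
  have yE : (k * h)%:R * a = k%:R * y by rewrite natrM -mulrA.
  rewrite coefZ coef_poly jp yE fE natrM -mulrN exprMn exprS.
  rewrite /c; move: (fact_neq0 charK jp) => u0.
  move: (_ ^+ j.+1) (_ ^+ j) (j.+1`!%:R : K) u0 (_`!%:R : K) v0.
  move=> e e' u u0 v v0; move: (binom _ _) => b; move: (k%:R : K) k0 => t t0.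
  by field; rewrite t0 u0 v0.
rewrite (sum_horner_natr charK szf) mulrN opprK (fE 0%N) mul0r sub0r expr0n.
(* The factor [0^j] leaves only [j = 0], the coefficient of [X]. *)
case: (j) => [|j'] in c v0 *; last by rewrite mul0r !mulr0.
rewrite /c !eqxx factS fact0 muln1 expr1 divr1 mul1r mulr1.
rewrite (binom_opp1 charK); last lia.
rewrite -signr_odd; have -> : odd (p.-1 - 1) by lia.
by rewrite mulrCA divfK // expr1 mulN1r opprK.
Qed.

End LaguerrePowers.

(** * Nonvanishing and the evaluation of [Gpoly] over rational functions *)

Section RationalFunctions.

#[local] Set Implicit Arguments.
#[local] Unset Strict Implicit.

Variable p : nat.
Hypotheses (pr_p : prime p) (odd_p : odd p).

Local Notation K := (Fpa p).

Let p_gt0 : (0 < p)%N := prime_gt0 pr_p.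

Lemma pchar_Fpa : p \in [pchar K].
Proof.
apply: (rmorph_pchar (@tofrac {poly 'F_p})).
by rewrite pchar_poly pchar_Fp.
Qed.

Let charK := pchar_Fpa.

(* The left-hand side is a polynomial in [alpha], whose value at [alpha = 0] is
   [binom (-1) (p-1)] *)
Lemma Laguerre_alpha_neq0 :
  Laguerre (alpha p ^+ p) (alpha p ^+ p - alpha p) != 0.
Proof.
pose P : {poly 'F_p} := \sum_(k < p)
  (\prod_(i < p.-1 - k) ('X^p - 1 - (i%:R)%:P)) * (((p.-1 - k)`!%:R)^-1)%:P
  * (- ('X^p - 'X)) ^+ k * ((k`!%:R)^-1)%:P.
have natE n : @tofrac {poly 'F_p} (n%:R)%:P = n%:R.
  by rewrite polyC_natr rmorph_nat.
have invE (n : nat) : @tofrac {poly 'F_p} ((n%:R)^-1)%:P = (n%:R)^-1.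
  have := fmorphV (@tofrac {poly 'F_p} \o @polyC 'F_p) n%:R.
  by rewrite /= natE.
have -> : Laguerre (alpha p ^+ p) (alpha p ^+ p - alpha p)
    = @tofrac {poly 'F_p} P.
  rewrite rmorph_sum /=; apply: eq_bigr => k _.
  rewrite !rmorphM rmorphXn rmorphN rmorphB rmorph_prod /= !invE rmorphXn /=.
  congr (_ / _ * _ / _); apply: eq_bigr => i _.
  by rewrite !rmorphB rmorph1 /= natE rmorphXn.
rewrite tofrac_eq0; apply/eqP => /(congr1 (horner^~ 0)) /eqP; apply/negP.
have charF : p \in [pchar 'F_p] by rewrite pchar_Fp.
(* At 0 the polynomial [X^p - X] vanishes, so only the term [k = 0] survives. *)
rewrite horner0 horner_sum (bigD1 (Ordinal p_gt0)) //=.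
rewrite [X in _ + X]big1 => [|k k0].
  rewrite addr0 expr0 mulr1 subn0 !hornerM !hornerC horner_prod.
  rewrite !mulf_neq0 ?invr_eq0 ?(fact_neq0 charF) ?ltn_predL //.
  apply/prodf_neq0 => i _.
  rewrite !(hornerD, hornerN, hornerXn, hornerC) expr0n (gtn_eqF p_gt0) sub0r.
  rewrite -opprD oppr_eq0 nat1r; apply: (natr_neq0 charF).
  by have := ltn_ord i; lia.
have {}k0 : (k != 0 :> nat)%N by [].
rewrite !hornerM horner_exp !hornerE expr0n (gtn_eqF p_gt0) subrr oppr0 expr0n.
by rewrite (negPf k0) mulr0 mul0r.
Qed.

Section Powers.

Variable a : K.

Local Notation E := (dlag p a).
Local Notation m := (asmod p a).

Lemma bprodS (g : K) k : (0 < k)%N -> bprod g k.+1 = bprod g k * bcoef 1 k g.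
Proof. by move=> k0; rewrite /bprod big_nat_recr. Qed.

Lemma dlag_exp h k : h%:R != 0 :> K -> (0 < k < p)%N ->
  (E h) ^+ k %% m = bprod (h%:R * a) k *: E (k * h).
Proof.
move=> h0 /andP[k_gt0]; rewrite -(prednK k_gt0); elim: k.-1 => [|j IHj] jp.
  rewrite expr1 mul1n /bprod big_geq // scale1r modp_small //.
  by rewrite (size_asmod charK) ltnS size_dlag.
have mulE : (E h * E (j.+1 * h)) %% m =
    bcoef 1 j.+1 (h%:R * a) *: E (j.+2 * h).
  exact: (dlag_mul charK odd_p a h0 (ltn0Sn j) jp).
rewrite exprS -modp_mul (IHj (ltnW jp)) -scalerAr modpZl mulE scalerA.
by rewrite -bprodS.
Qed.

Hypothesis lam0 : (E 1) ^+ p %% m != 0.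

(** If the product vanished, so would [E_h^k] modulo [m]. As [E_1^h] is a scalar multiple of [E_h],
    the power [E_1^(hk)] would vanish too, against [dlag1_exp_neq0]. *)
Lemma bprod_neq0 h k : (0 < h < p)%N -> (0 < k < p)%N ->
  bprod (h%:R * a) k != 0.
Proof.
move=> hp kp; have h0 : h%:R != 0 :> K by apply: (natr_neq0 charK).
have := dlag1_exp_neq0 charK odd_p (h * k) lam0.
apply: contraNneq => b0.
rewrite exprM -modp_exp dlag_exp ?oner_neq0 // muln1 exprZn modpZl.
by rewrite dlag_exp // b0 scale0r scaler0.
Qed.

(** The scalars produced by [dlag_exp] cancel the denominators of [Gpoly], leaving the sum of
    [sum_inv_dlag]. *)
Lemma Gpoly_comp_dlag h : (0 < h < p)%N ->
  (Gpoly (h%:R * a) \Po E h) %% m = h%:R *: 'X.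
Proof.
move=> hp; have h0 : h%:R != 0 :> K by apply: (natr_neq0 charK).
rewrite -(sum_inv_dlag charK odd_p a h) /Gpoly.
rewrite rmorphN rmorph_sum /= modpN modp_sum; congr (- _).
apply: eq_big_nat => k kp.
rewrite comp_polyZ rmorphXn /= comp_polyX modpZl dlag_exp //.
by rewrite scalerA divfK ?bprod_neq0.
Qed.

End Powers.

End RationalFunctions.

Theorem theorem8 (p : nat) (pr_p : prime p) (odd_p : odd p) (h : nat)
    (h_gt0 : (0 < h)%N) (h_ltp : (h < p)%N) :
  modulus p %| (Gpoly (h%:R * alpha p) \Po ((bprod (alpha p) h)^-1 *: 'X^h)
                - (h%:R : Fpa p) *: Gpoly (alpha p)).
Proof.
have charK := pchar_Fpa pr_p.
have p1 : (0 < 1 < p)%N by rewrite prime_gt1.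
have hp : (0 < h < p)%N by rewrite h_gt0.
pose lam := Laguerre (alpha p ^+ p) (alpha p ^+ p - alpha p).
have lamE : (dlag p (alpha p) 1) ^+ p %% asmod p (alpha p) = lam%:P.
  exact: dlag1_expp.
have lam0 : (dlag p (alpha p) 1) ^+ p %% asmod p (alpha p) != 0.
  by rewrite lamE polyC_eq0 Laguerre_alpha_neq0.
have G1 := Gpoly_comp_dlag pr_p odd_p lam0 p1.
have Gh := Gpoly_comp_dlag pr_p odd_p lam0 hp.
rewrite mul1r scale1r in G1.
have b0 : bprod (alpha p) h != 0.
  by have := bprod_neq0 pr_p odd_p lam0 p1 hp; rewrite mul1r.
have eh_E := dlag_exp pr_p odd_p (alpha p) (oner_neq0 _ : 1%:R != 0) hp.
rewrite mul1r muln1 in eh_E.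
exact: (dvdp_comp_inverse _ _ _ _ _ _ _ _ _ _ _ (prime_gt1 pr_p)
  (size_asmod charK (alpha p)) lamE b0 eh_E G1 Gh).
Qed.
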